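(* For problem (D) with $\Psi_\mu=\Psi_{+,\mu}$: (i) every stationary point of (D) is a local minimizer of $G$; (ii) if $w^*=[y^*;z^*]$ is a local minimizer of $G$ with $G(w^* )<\infty$ and the Slater condition $$\{w=[y;z]:\ -A^\top y-B^\top z\in\operatorname{ri}(\operatorname{dom}f^* ),\ y\in\operatorname{ri}(\operatorname{dom}g^* ),\ z_{\bar T_*}=0,\ z_{T_*}\ge0\}\neq\emptyset$$ holds, where $T_*=\{i:z^*_i\ne0\}$, $\bar T_*=[r]\setminus T_*$, and ''$\operatorname{ri}$'' may be omitted for $f^*$ (resp. $g^*$) when it is polyhedral, then $w^*$ is a stationary point of (D).
   Context: Let $f:\mathbb R^n\to(-\infty,\infty]$, $g:\mathbb R^m\to(-\infty,\infty]$ be proper, lsc and convex with conjugates $f^*,g^*$; $A\in\mathbb R^{m\times n}$, $B\in\mathbb R^{r\times n}$, $b\in\mathbb R^r$, $\mu\in\mathbb R^r$, $\mu>0$. For $w=[y;z]\in\mathbb R^m\times\mathbb R^r$: $\Xi(w)=f^*(-A^\top y-B^\top z)+g^*(y)+\langle b,z\rangle$, $\Psi_{+,\mu}(z)=\sum_i\mu_i\mathbf 1_{\{z_i\neq0\}}+\delta(z\mid\mathbb R^r_+)$, and (D) is $\min_w G(w)=\Xi(w)+\Psi_{+,\mu}(z)$. $\partial$ is the limiting subdifferential; $\partial\Psi_{+,\mu}(z)=\{u:u_i\in\mathbb R\text{ if }z_i=0,\ u_i=0\text{ otherwise}\}$ for $z\ge0$ and $\emptyset$ otherwise. $w^*$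 is a stationary point of (D) if there exist $x\in\partial f^*(-A^\top y^*-B^\top z^* )$, $v\in\partial g^*(y^* )$, $u\in\partial\Psi_{+,\mu}(z^* )$ with $Ax=v$ and $Bx=b+u$. $\operatorname{ri}$ denotes relative interior. *)

(* Defs.v *)
From HB Require Import structures.
From mathcomp Require Import all_boot all_order all_algebra.
From mathcomp Require Import all_classical all_reals all_analysis.
Set Implicit Arguments. Unset Strict Implicit. Unset Printing Implicit Defensive.
Import Order.TTheory GRing.Theory Num.Theory.
Import numFieldNormedType.Exports.
Local Open Scope classical_set_scope.
Local Open Scope ring_scope.

Definition dotv {R : realType} {k : nat} (x y : 'cV[R]_k) : R :=
  \sum_(i < k) x i 0 * y i 0.

Definition enorm {R : realType} {k : nat} (x : 'cV[R]_k) : R :=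
  Num.sqrt (dotv x x).

Definition edom {R : realType} {k : nat} (h : 'cV[R]_k -> \bar R) : set 'cV[R]_k :=
  [set x | (h x < +oo)%E].

Definition proper_fun {R : realType} {k : nat} (h : 'cV[R]_k -> \bar R) : Prop :=
  (forall x, h x != -oo%E) /\ (exists x, h x < +oo)%E.

Definition lsc_fun {R : realType} {k : nat} (h : 'cV[R]_k -> \bar R) : Prop :=
  forall (x : 'cV[R]_k) (s : nat -> 'cV[R]_k),
    s @ \oo --> x -> (h x <= limn_einf (fun j => h (s j)))%E.

(* convexity (for functions never equal to -oo) *)
Definition convex_fun {R : realType} {k : nat} (h : 'cV[R]_k -> \bar R) : Prop :=
  forall (x y : 'cV[R]_k) (t : R), 0 < t < 1 ->
    (h (t *: x + (1 - t) *: y)%R <= t%:E * h x + (1 - t)%:E * h y)%E.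

Definition conj_fun {R : realType} {k : nat} (h : 'cV[R]_k -> \bar R)
  (p : 'cV[R]_k) : \bar R :=
  ereal_sup (range (fun x => ((dotv p x)%:E - h x)%E)).

(* Frechet (regular) subdifferential:
   v \in \hat\partial h(x) iff h(x) finite and
   liminf_{y -> x, y <> x} (h y - h x - <v, y - x>) / |y - x| >= 0 *)
Definition frechet_subdiff {R : realType} {k : nat} (h : 'cV[R]_k -> \bar R)
  (x : 'cV[R]_k) : set 'cV[R]_k :=
  [set v | h x \is a fin_num /\
     forall eps : R, 0 < eps -> exists2 delta : R, 0 < delta &
       forall y, enorm (y - x) < delta ->
         (h x + (dotv v (y - x) - eps * enorm (y - x))%:E <= h y)%E].

Definition limiting_subdiff {R : realType} {k : nat} (h : 'cV[R]_k -> \bar R)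
  (x : 'cV[R]_k) : set 'cV[R]_k :=
  [set v | h x \is a fin_num /\
     exists (xs vs : nat -> 'cV[R]_k),
       [/\ xs @ \oo --> x, (fun j => h (xs j)) @ \oo --> h x,
           (forall j, frechet_subdiff h (xs j) (vs j)) & vs @ \oo --> v]].

Definition aff_hull {R : realType} {k : nat} (C : set 'cV[R]_k) : set 'cV[R]_k :=
  [set v | exists (N : nat) (c : 'I_N -> 'cV[R]_k) (t : 'I_N -> R),
     [/\ forall i, C (c i), \sum_(i < N) t i = 1 & v = \sum_(i < N) t i *: c i]].

Definition rel_int {R : realType} {k : nat} (C : set 'cV[R]_k) : set 'cV[R]_k :=
  [set x | C x /\ exists2 eps : R, 0 < eps &
     forall y, aff_hull C y -> enorm (y - x) < eps -> C y].

Definition polyhedral_fun {R : realType} {k : nat} (h : 'cV[R]_k -> \bar R) : Prop :=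
  exists (N : nat) (a : 'I_N -> 'cV[R]_k) (beta alpha : 'I_N -> R),
    forall (x : 'cV[R]_k) (t : R),
      (h x <= t%:E)%E <-> (forall i, dotv (a i) x + beta i * t <= alpha i).

Definition Psi_plus {R : realType} {r : nat} (mu : 'cV[R]_r) (z : 'cV[R]_r) : \bar R :=
  if [forall i, 0 <= z i 0]
  then (\sum_(i < r) (if z i 0 != 0 then mu i 0 else 0))%:E
  else +oo%E.

Definition Psi_plus_subdiff {R : realType} {r : nat} (z : 'cV[R]_r) : set 'cV[R]_r :=
  [set u | (forall i, 0 <= z i 0) /\ (forall i, z i 0 != 0 -> u i 0 = 0)].

Definition Xi {R : realType} {n m r : nat} (f : 'cV[R]_n -> \bar R)
  (g : 'cV[R]_m -> \bar R) (A : 'M[R]_(m, n)) (B : 'M[R]_(r, n)) (b : 'cV[R]_r)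
  (y : 'cV[R]_m) (z : 'cV[R]_r) : \bar R :=
  (conj_fun f (- (A^T *m y) - B^T *m z) + conj_fun g y + (dotv b z)%:E)%E.

Definition Gobj {R : realType} {n m r : nat} (f : 'cV[R]_n -> \bar R)
  (g : 'cV[R]_m -> \bar R) (A : 'M[R]_(m, n)) (B : 'M[R]_(r, n)) (b mu : 'cV[R]_r)
  (y : 'cV[R]_m) (z : 'cV[R]_r) : \bar R :=
  (Xi f g A B b y z + Psi_plus mu z)%E.

Definition local_min_D {R : realType} {n m r : nat} (f : 'cV[R]_n -> \bar R)
  (g : 'cV[R]_m -> \bar R) (A : 'M[R]_(m, n)) (B : 'M[R]_(r, n)) (b mu : 'cV[R]_r)
  (ys : 'cV[R]_m) (zs : 'cV[R]_r) : Prop :=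
  exists2 eps : R, 0 < eps &
    forall y z, Num.sqrt (enorm (y - ys) ^+ 2 + enorm (z - zs) ^+ 2) < eps ->
      (Gobj f g A B b mu ys zs <= Gobj f g A B b mu y z)%E.

Definition stationary_D {R : realType} {n m r : nat} (f : 'cV[R]_n -> \bar R)
  (g : 'cV[R]_m -> \bar R) (A : 'M[R]_(m, n)) (B : 'M[R]_(r, n)) (b : 'cV[R]_r)
  (ys : 'cV[R]_m) (zs : 'cV[R]_r) : Prop :=
  exists (x : 'cV[R]_n) (v : 'cV[R]_m) (u : 'cV[R]_r),
    [/\ limiting_subdiff (conj_fun f) (- (A^T *m ys) - B^T *m zs) x,
        limiting_subdiff (conj_fun g) ys v,
        Psi_plus_subdiff zs u,
        A *m x = v & B *m x = b + u].

Definition slater_D {R : realType} {n m r : nat} (f : 'cV[R]_n -> \bar R)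
  (g : 'cV[R]_m -> \bar R) (A : 'M[R]_(m, n)) (B : 'M[R]_(r, n))
  (zs : 'cV[R]_r) : Prop :=
  exists (y : 'cV[R]_m) (z : 'cV[R]_r),
    [/\ rel_int (edom (conj_fun f)) (- (A^T *m y) - B^T *m z)
        \/ (polyhedral_fun (conj_fun f) /\ edom (conj_fun f) (- (A^T *m y) - B^T *m z)),
        rel_int (edom (conj_fun g)) y
        \/ (polyhedral_fun (conj_fun g) /\ edom (conj_fun g) y),
        (forall i, zs i 0 = 0 -> z i 0 = 0) &
        (forall i, zs i 0 != 0 -> 0 <= z i 0)].

(* Main.v *)
(** (i) For convex functions limiting subgradients are global subgradients, so
    at a stationary point [Xi] grows at least like [- <u, z - zs>]; near [zs] this
    loss is dominated by the jump [mu i] paid by each coordinate leaving zero.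

    (ii) Near [zs] the penalty is constant on the subspace [z_i = 0] wherever [zs_i = 0],
    so convexity makes [(ys, zs)] a global minimizer of [Xi] on that subspace.
    Splitting the variables as [p = - A^T q - B^T z] and passing to epigraphs
    yields an affine objective on a convex set [D] under finitely many affine
    inequalities: a function satisfying Slater's condition in the relative
    interior puts its epigraph into [D], a polyhedral one contributes the
    inequalities of its epigraph. Multipliers exist as soon as some feasible
    point lies in the relative core of [D]; those of the splitting constraint
    form the vector [x]. *)

Require Import Defs.
From HB Require Import structures.
From mathcomp Require Import all_boot all_order all_algebra.
From mathcomp Require Import all_classical all_reals all_analysis.
From mathcomp Require Import ring lra.
Import Order.TTheory GRing.Theory Num.Theory.
Import numFieldNormedType.Exports.
Set Implicit Arguments. Unset Strict Implicit. Unset Printing Implicit Defensive.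
Local Open Scope classical_set_scope.
Local Open Scope ring_scope.

(** * Lagrange multipliers for affine inequalities on a convex set *)

Definition affine_fun {R : realType} {V : lmodType R} (a : V -> R) : Prop :=
  forall (t : R) x y, a (t *: x + (1 - t) *: y) = t * a x + (1 - t) * a y.

Definition convex_subset {R : realType} {V : lmodType R} (D : set V) : Prop :=
  forall (t : R) x y, 0 <= t <= 1 -> D x -> D y -> D (t *: x + (1 - t) *: y).

(* Algebraic relative interior: every segment of [D] ending at [s] can be
   prolonged beyond [s] inside [D]. *)
Definition rel_core {R : realType} {V : lmodType R} (D : set V) (s : V) : Prop :=
  D s /\ forall w, D w -> exists2 t : R, 1 < t & D (t *: s + (1 - t) *: w).

Section Multipliers.
Variables (R : realType) (V : lmodType R).
Implicit Types (D : set V) (a c : V -> R).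

Lemma affine_funD a c : affine_fun a -> affine_fun c ->
  affine_fun (fun w => a w + c w).
Proof. by move=> ha hc t x y; rewrite ha hc; ring. Qed.

Lemma affine_funZ (k : R) a : affine_fun a -> affine_fun (fun w => k * a w).
Proof. by move=> ha t x y; rewrite ha; ring. Qed.

Lemma affine_fun_sum N (a : 'I_N -> V -> R) :
  (forall i, affine_fun (a i)) -> affine_fun (fun w => \sum_i a i w).
Proof.
move=> ha t x y; rewrite !mulr_sumr -big_split /=.
by apply: eq_bigr => i _; exact: ha.
Qed.

(** The points between [s] and a prolonged point are convex combinations of the two. Any smaller
    factor therefore works too, so that two sets can share a common factor. *)
Lemma rel_core_shrink D s w : convex_subset D -> rel_core D s -> D w ->
  exists2 t : R, 1 < t & forall t', 1 <= t' <= t -> D (t' *: s + (1 - t') *: w).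
Proof.
move=> cvxD [Ds core] Dw; have [t t1 Dt] := core _ Dw.
exists t => // t' /andP[t'1 t't]; pose th := (t' - 1) / (t - 1).
have th01 : 0 <= th <= 1 by rewrite divr_ge0 ?ler_pdivrMr //=; lra.
suff -> : t' *: s + (1 - t') *: w =
    th *: (t *: s + (1 - t) *: w) + (1 - th) *: s by exact: cvxD.
have thE : th * (t - 1) = t' - 1 by rewrite divfK // gt_eqF // subr_gt0.
rewrite scalerDr !scalerA addrAC -scalerDl; clearbody th.
by congr (_ *: _ + _ *: _); lra.
Qed.

(** Each point with [a > 0] bounds [nu] from below, each point with [a < 0] from above. The segment
    joining two such points crosses [a = 0], where [c >= 0]; this puts every lower bound below every
    upper one, and [nu] is the supremum of the lower bounds. *)
Lemma multiplier_step D a c :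
  convex_subset D -> affine_fun a -> affine_fun c ->
  (forall w, D w -> a w = 0 -> 0 <= c w) ->
  (exists2 w, D w & a w < 0) -> (exists2 w, D w & 0 < a w) ->
  exists nu : R, forall w, D w -> 0 <= c w + nu * a w.
Proof.
move=> cvxD ha hc c0 [w0 Dw0 aw0] [w1 Dw1 aw1].
have key w w' : D w -> D w' -> 0 < a w -> a w' < 0 ->
    - c w / a w <= c w' / - a w'.
  move=> Dw Dw' aw aw'.
  have d0 : 0 < a w - a w' by lra.
  pose t := - a w' / (a w - a w').
  have t01 : 0 <= t <= 1.
    by rewrite /t divr_ge0 ?ler_pdivrMr //=; lra.
  have tE : t * (a w - a w') = - a w' by rewrite /t divfK // gt_eqF.
  have := c0 _ (cvxD _ _ _ t01 Dw Dw').
  rewrite ha hc => /(_ _) cge.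
  have {}cge : 0 <= t * c w + (1 - t) * c w' by apply: cge; nra.
  rewrite ler_pdivrMr // mulrAC ler_pdivlMr; last by lra.
  have : 0 <= (t * c w + (1 - t) * c w') * (a w - a w') by apply: mulr_ge0 => //; exact: ltW.
  have -> : (t * c w + (1 - t) * c w') * (a w - a w') =
    (t * (a w - a w')) * c w + ((a w - a w') - t * (a w - a w')) * c w' by ring.
  rewrite tE; lra.
pose S := [set - c w / a w | w in [set w | D w /\ 0 < a w]].
have S0 : S !=set0 by exists (- c w1 / a w1); exists w1.
have Sub w' : D w' -> a w' < 0 -> ubound S (c w' / - a w').
  by move=> Dw' aw' _ [w [Dw aw] <-]; exact: key.
exists (sup S) => w Dw; case: (ltgtP (a w) 0) => aw.
- have := ge_sup S0 (Sub _ Dw aw); rewrite ler_pdivlMr; last by lra.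
  lra.
- have : - c w / a w <= sup S.
    by apply: ub_le_sup; [exists (c w0 / - a w0); exact: Sub|exists w].
  rewrite ler_pdivrMr //; lra.
- by rewrite aw mulr0 addr0; exact: c0.
Qed.

(* When no point of [D] satisfying the other constraints is strictly feasible
   for the first one, the induction hypothesis applied to that constraint as an
   objective yields a combination [e] of the constraints vanishing on [D]; the
   first constraint may then be treated as an equality, and a multiplier of the
   wrong sign is repaired by adding a multiple of [e]. *)
Lemma affine_multipliers N (a : 'I_N -> V -> R) D s c :
  convex_subset D -> rel_core D s ->
  (forall i, affine_fun (a i)) -> affine_fun c ->
  (forall i, a i s <= 0) ->
  (forall w, D w -> (forall i, a i w <= 0) -> 0 <= c w) ->
  exists2 lam : 'I_N -> R, forall i, 0 <= lam i &
    forall w, D w -> 0 <= c w + \sum_i lam i * a i w.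
Proof.
elim: N a D c => [|N IH] a D c cvxD cores ha hc sa c0.
  exists (fun=> 0) => // w Dw; rewrite big_ord0 addr0.
  by apply: c0 => // -[].
pose a0 := a ord0; pose a' i := a (lift ord0 i).
have ha0 : affine_fun a0 by exact: ha.
have ha' i : affine_fun (a' i) by exact: ha.
have sa' i : a' i s <= 0 by exact: sa.
have feas w : a0 w <= 0 -> (forall i, a' i w <= 0) -> forall i, a i w <= 0.
  by move=> h0 h' i; case: (unliftP ord0 i) => [j ->|->]; [exact: h'|exact: h0].
suff [k k0 [lam lam0 H]] : exists2 k : R, 0 <= k & exists2 lam : 'I_N -> R,
    forall i, 0 <= lam i &
    forall w, D w -> 0 <= (c w + k * a0 w) + \sum_i lam i * a' i w.
  exists (fun i => if unlift ord0 i is Some j then lam j else k).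
    by move=> i; case: unliftP => [j _|_].
  move=> w Dw; rewrite big_ord_recl unlift_none addrA.
  by under eq_bigr do rewrite liftK; exact: H.
pose D' := [set w | D w /\ forall i, a' i w <= 0].
have cvxD' : convex_subset D'.
  move=> t x y t01 [Dx ax] [Dy ay]; split; first exact: cvxD.
  by move=> i; rewrite ha'; have := ax i; have := ay i; nra.
(* If the first constraint is strictly feasible on [D'], its multiplier is found there, and the
   induction hypothesis handles the objective [c + k * a0]. *)
have [[w0 [Dw0 aw0] a0w0]|nostrict] := pselect (exists2 w, D' w & a0 w < 0).
  have [k k0 kP] : exists2 k, 0 <= k & forall w, D' w -> 0 <= c w + k * a0 w.
    have [[w1 Dw1 a0w1]|nopos] := pselect (exists2 w, D' w & 0 < a0 w); last first.
      exists 0 => // w [Dw aw]; rewrite mul0r addr0; apply: c0 => //.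
      apply: feas => //; rewrite leNgt; apply/negP => aw0'.
      by apply: nopos; exists w.
    have [||k kP] := @multiplier_step D' a0 c cvxD' ha0 hc _ _ (ex_intro2 _ _ _ Dw1 a0w1).
    - by move=> w [Dw aw] a0w; apply: c0 => //; apply: feas => //; rewrite a0w.
    - by exists w0.
    have [k0|k0] := leP 0 k; first by exists k.
    (* A negative [k] may be replaced by 0: where [a0 w > 0], [c w + k * a0 w >= 0] already forces
       [c w >= 0]. *)
    exists 0 => // w D'w; rewrite mul0r addr0.
    have [aw|aw] := leP (a0 w) 0.
      by case: (D'w) => Dw a'w; apply: c0 => //; apply: feas.
    have := kP _ D'w; nra.
  exists k => //; apply: IH => //.
    by apply: affine_funD => //; exact: affine_funZ.
  by move=> w Dw aw; exact: kP.
have a0ge w : D w -> (forall i, a' i w <= 0) -> 0 <= a0 w.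
  move=> Dw aw; rewrite leNgt; apply/negP => lt0.
  by apply: nostrict; exists w.
case: (cores) => Ds core.
have a0s : a0 s = 0 by apply/eqP; rewrite eq_le sa /= a0ge.
have [mu mu0 muP] := IH a' D a0 cvxD cores ha' ha0 sa' a0ge.
pose e w := a0 w + \sum_i mu i * a' i w.
have he : affine_fun e.
  by apply: affine_funD => //; apply: affine_fun_sum => i; exact: affine_funZ.
have es : e s <= 0.
  rewrite /e a0s add0r -oppr_ge0 -sumrN; apply: sumr_ge0 => i _.
  by have := mu0 i; have := sa' i; nra.
(* The affine [e] is nonnegative on [D] and at most 0 at [s]; a positive value at [w] would make it
   negative on the prolongation beyond [s]. *)
have e0 w : D w -> e w = 0.
  move=> Dw; have [t t1 Dt] := core _ Dw; apply/eqP; rewrite eq_le (muP _ Dw) andbT.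
  by have := muP _ Dt; rewrite -/(e _) he; nra.
pose E := [set w | D w /\ a0 w = 0].
have cvxE : convex_subset E.
  move=> t x y t01 [Dx ax] [Dy ay]; split; first exact: cvxD.
  by rewrite ha0 ax ay !mulr0 addr0.
have coreE : rel_core E s.
  split=> // w [Dw aw]; have [t t1 Dt] := core _ Dw; exists t => //; split=> //.
  by rewrite ha0 a0s aw !mulr0 addr0.
have [|lam lam0 lamP] := IH a' E c cvxE coreE ha' hc sa'.
  by move=> w [Dw aw] a'w; apply: c0 => //; apply: feas => //; rewrite aw.
pose c' w := c w + \sum_i lam i * a' i w.
have hc' : affine_fun c'.
  by apply: affine_funD => //; apply: affine_fun_sum => i; exact: affine_funZ.
have [nu nuP] : exists nu, forall w, D w -> 0 <= c' w + nu * a0 w.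
  (* Since [a0 s = 0], prolonging through [s] reverses the sign of [a0]; unless it vanishes on [D],
     [a0] takes both signs, as [multiplier_step] requires. *)
  have flip w : D w -> exists2 t : R, 1 < t &
      exists2 w', D w' & a0 w' = (1 - t) * a0 w.
    move=> Dw; have [t t1 Dt] := core _ Dw; exists t => //.
    by exists (t *: s + (1 - t) *: w) => //; rewrite ha0 a0s mulr0 add0r.
  have [[w Dw aw]|/forall2NP nz] := pselect (exists2 w, D w & a0 w != 0); last first.
    exists 0 => w Dw; rewrite mul0r addr0; apply: lamP; split=> //.
    by case: (nz w) => // /negP; rewrite negbK => /eqP.
  have [t t1 [w' Dw' aw']] := flip _ Dw.
  apply: multiplier_step => //.
  - by move=> v Dv av; exact: lamP.
  - by case: (ltgtP (a0 w) 0) aw => // aw _; [exists w|exists w' => //; nra].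
  - by case: (ltgtP (a0 w) 0) aw => // aw _; [exists w' => //; nra|exists w].
have [nu0|nu0] := leP 0 nu.
  exists nu => //; exists lam => // w Dw.
  by rewrite addrAC; exact: nuP.
exists 0 => //; exists (fun i => lam i - nu * mu i).
  by move=> i; have := lam0 i; have := mu0 i; nra.
move=> w Dw; have := nuP _ Dw; rewrite /c' mul0r addr0.
under [X in _ -> 0 <= _ + X]eq_bigr do rewrite mulrBl -mulrA.
rewrite sumrB -mulr_sumr; have := e0 _ Dw; rewrite /e.
set S := \sum_i mu i * _; move=> /eqP; rewrite addrC addr_eq0 => /eqP ->.
by rewrite mulrN opprK addrA.
Qed.

Lemma affine_multipliers_fin (I : finType) (a : I -> V -> R) D s c :
  convex_subset D -> rel_core D s ->
  (forall i, affine_fun (a i)) -> affine_fun c ->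
  (forall i, a i s <= 0) ->
  (forall w, D w -> (forall i, a i w <= 0) -> 0 <= c w) ->
  exists2 lam : I -> R, forall i, 0 <= lam i &
    forall w, D w -> 0 <= c w + \sum_i lam i * a i w.
Proof.
move=> cvxD cores ha hc sa c0.
have [|||lam lam0 lamP] :=
    @affine_multipliers #|I| (fun j => a (enum_val j)) D s c cvxD cores _ hc.
- by move=> i; exact: ha.
- by move=> i; exact: sa.
- by move=> w Dw aw; apply: c0 => // i; rewrite -(enum_rankK i); exact: aw.
exists (fun i => lam (enum_rank i)) => // w Dw.
rewrite big_enum_val /=; under eq_bigr do rewrite enum_valK.
exact: lamP.
Qed.

End Multipliers.

Lemma rel_core_prod (R : realType) (V W : lmodType R) (D : set V) (E : set W) s u :
  convex_subset D -> convex_subset E -> rel_core D s -> rel_core E u ->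
  rel_core [set w : V * W | D w.1 /\ E w.2] (s, u).
Proof.
move=> cD cE Ds Eu; split; first by split=> /=; [case: Ds|case: Eu].
move=> [v w] /= [Dv Ew].
have [t1 t11 Dt] := rel_core_shrink cD Ds Dv.
have [t2 t21 Et] := rel_core_shrink cE Eu Ew.
exists (Num.min t1 t2); first by rewrite lt_min t11.
by split; [apply: Dt|apply: Et]; rewrite le_min ge_min lexx ?orbT ltW //= ltW.
Qed.

(** * Euclidean inner product and norm *)

Section Dot.
Variable R : realType.

Lemma dotvC k (x y : 'cV[R]_k) : dotv x y = dotv y x.
Proof. by apply: eq_bigr => i _; rewrite mulrC. Qed.

Lemma dotvDr k (x y z : 'cV[R]_k) : dotv x (y + z) = dotv x y + dotv x z.
Proof. by rewrite -big_split; apply: eq_bigr => i _; rewrite mxE mulrDr. Qed.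

Lemma dotvZr k (t : R) (x y : 'cV[R]_k) : dotv x (t *: y) = t * dotv x y.
Proof. by rewrite mulr_sumr; apply: eq_bigr => i _; rewrite mxE mulrCA. Qed.

Lemma dotvNr k (x y : 'cV[R]_k) : dotv x (- y) = - dotv x y.
Proof. by rewrite -scaleN1r dotvZr mulN1r. Qed.

Lemma dotvBr k (x y z : 'cV[R]_k) : dotv x (y - z) = dotv x y - dotv x z.
Proof. by rewrite dotvDr dotvNr. Qed.

Lemma dotvDl k (x y z : 'cV[R]_k) : dotv (x + y) z = dotv x z + dotv y z.
Proof. by rewrite dotvC dotvDr !(dotvC z). Qed.

Lemma dotvZl k (t : R) (x y : 'cV[R]_k) : dotv (t *: x) y = t * dotv x y.
Proof. by rewrite dotvC dotvZr dotvC. Qed.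

Lemma dotvBl k (x y z : 'cV[R]_k) : dotv (x - y) z = dotv x z - dotv y z.
Proof. by rewrite dotvC dotvBr !(dotvC z). Qed.

Lemma dotv_trmx k l (M : 'M[R]_(k, l)) (x : 'cV[R]_l) (y : 'cV[R]_k) :
  dotv x (M^T *m y) = dotv (M *m x) y.
Proof.
have dotvE p (u v : 'cV[R]_p) : dotv u v = (u^T *m v) 0 0.
  by rewrite mxE; apply: eq_bigr => i _; rewrite mxE.
by rewrite !dotvE trmx_mul mulmxA.
Qed.

Lemma dotv_delta k (x : 'cV[R]_k) i : dotv x (delta_mx i 0) = x i 0.
Proof.
rewrite /dotv (bigD1 i) //= mxE !eqxx mulr1 big1 ?addr0 // => j ji.
by rewrite mxE (negbTE ji) mulr0.
Qed.

Lemma enorm_ge0 k (x : 'cV[R]_k) : 0 <= enorm x.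
Proof. exact: sqrtr_ge0. Qed.

Lemma enormZ k (t : R) (x : 'cV[R]_k) : enorm (t *: x) = `|t| * enorm x.
Proof.
by rewrite /enorm dotvZr dotvZl mulrA -expr2 sqrtrM ?sqr_ge0 // sqrtr_sqr.
Qed.

Lemma coord_le_enorm k (x : 'cV[R]_k) i : `|x i 0| <= enorm x.
Proof.
rewrite -sqrtr_sqr ler_wsqrtr // /dotv (bigD1 i) //= -expr2 lerDl.
by apply: sumr_ge0 => j _; rewrite -expr2 sqr_ge0.
Qed.

Lemma cvg_dotv k (x y : nat -> 'cV[R]_k) (x0 y0 : 'cV[R]_k) :
  x @ \oo --> x0 -> y @ \oo --> y0 ->
  (fun j => dotv (x j) (y j)) @ \oo --> dotv x0 y0.
Proof.
move=> hx hy; apply: cvg_big; first exact: add_continuous.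
move=> i _; have coord (s : nat -> 'cV[R]_k) (l : 'cV[R]_k) : s @ \oo --> l ->
    (fun j => s j i 0) @ \oo --> l i 0.
  move=> sl; apply: (@cvg_comp _ _ _ s (fun M : 'cV[R]_k => M i 0) _ _ _ sl).
  exact: coord_continuous.
by apply: cvgM; exact: coord.
Qed.

Lemma finite_pos_lb (I : finType) (d : I -> R) : (forall i, 0 < d i) ->
  exists2 e : R, 0 < e & forall i, e <= d i.
Proof.
move=> d0; exists (\big[Order.min/1]_i d i).
  by apply: lt_bigmin => // i _; exact: d0.
by move=> i; exact: bigmin_le.
Qed.

End Dot.

(** * Conjugates, subgradients and epigraphs *)

Section Conjugate.
Variables (R : realType) (k : nat).
Implicit Types (h f : 'cV[R]_k -> \bar R).

(** Convexity of the epigraph; with real upper bounds, no arithmetic on infinite values arises. *)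
Definition epi_convex h : Prop :=
  forall (t : R) x y (a b : R), 0 <= t <= 1 -> (h x <= a%:E)%E -> (h y <= b%:E)%E ->
    (h (t *: x + (1 - t) *: y)%R <= (t * a + (1 - t) * b)%:E)%E.

Lemma conj_fun_leP f p (t : R) : (forall x, f x != -oo%E) ->
  (conj_fun f p <= t%:E)%E <->
  (forall x, (f x < +oo)%E -> dotv p x - fine (f x) <= t).
Proof.
move=> fN; split=> H.
  move=> x fx; rewrite -lee_fin EFinB fineK.
    by apply: le_trans H; apply: ereal_sup_ubound; exists x.
  by rewrite fin_numE fN lt_eqF.
apply: ge_ereal_sup => _ [x _ <-].
have := H x; have := fN x; case: (f x) => [a _ /(_ (ltry _))| _ _|//].
  by rewrite -EFinB lee_fin.
by rewrite /= leNye.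
Qed.

Lemma conj_fun_epi_convex f : (forall x, f x != -oo%E) -> epi_convex (conj_fun f).
Proof.
move=> fN t x y a b t01 /conj_fun_leP hx /conj_fun_leP hy.
apply/conj_fun_leP => // u fu; rewrite dotvDl !dotvZl.
have := hx fN _ fu; have := hy fN _ fu; nra.
Qed.

Lemma conj_fun_neqNy f p : proper_fun f -> conj_fun f p != -oo%E.
Proof.
move=> [fN [x fx]].
have : ((dotv p x)%:E - f x <= conj_fun f p)%E.
  by apply: ereal_sup_ubound; exists x.
by have := fN x; case: (f x) fx => // a _ _; case: (conj_fun f p).
Qed.

(** The local inequality is applied at a point of the segment from [x] to [y] close to [x];
    convexity bounds [h] there, and dividing by the step [s] makes the inequality global up to an
    arbitrary [e]. *)
Lemma frechet_subdiff_convex h x v : epi_convex h -> frechet_subdiff h x v ->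
  forall y (t : R), (h y <= t%:E)%E -> fine (h x) + dotv v (y - x) <= t.
Proof.
move=> cvxh [hx hv] y t hy; apply/ler_addgt0Pr => e e0.
pose N := enorm (y - x); have N0 : 0 <= N := enorm_ge0 _.
(* Over the distance [N] this tolerance costs at most [e]; the step [s] below satisfies
   [s * N < d]. *)
have [|d d0 dP] := hv (e / (N + 1)); first by rewrite divr_gt0 //; lra.
pose s := d / (d + N).
have dN : 0 < d + N by lra.
have s0 : 0 < s by rewrite divr_gt0.
have sE : s * (d + N) = d by rewrite divfK // gt_eqF.
have s1 : 0 <= s <= 1 by rewrite ltW //= ler_pdivrMr //; lra.
have yE : s *: y + (1 - s) *: x - x = s *: (y - x).
  by apply/colP => i; rewrite !mxE; ring.
have := cvxh s y x t (fine (h x)) s1 hy; rewrite fineK // lexx => /(_ isT) H.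
have := le_trans (dP _ _) H; rewrite yE enormZ -/N gtr0_norm // => /(_ _) H'.
have {H'}/H' : s * N < d by nra.
rewrite -(fineK hx) -EFinD lee_fin dotvZr => H'.
have eN : e / (N + 1) * N <= e.
  rewrite mulrAC ler_pdivrMr; nra.
have : s * (fine (h x) + dotv v (y - x)) <= s * (t + e).
  have : s * (e / (N + 1) * N) <= s * e by apply: ler_wpM2l => //; exact: ltW.
  by nra.
by rewrite ler_pM2l.
Qed.

(** The global inequality at each [xs j] passes to the limit, because the values [h (xs j)] converge
    along with the points and the subgradients. *)
Lemma limiting_subdiff_convex h x v : epi_convex h -> limiting_subdiff h x v ->
  forall y (t : R), (h y <= t%:E)%E -> fine (h x) + dotv v (y - x) <= t.
Proof.
move=> cvxh [hx [xs [vs [xsx hxs frs vsv]]]] y t hy.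
have lim : (fun j => fine (h (xs j)) + dotv (vs j) (y - xs j)) @ \oo -->
    fine (h x) + dotv v (y - x).
  apply: cvgD; first by apply: fine_cvg; rewrite fineK.
  by apply: cvg_dotv => //; apply: cvgB => //; exact: cvg_cst.
apply: (cvgr_to_le lim).
by apply: nearW => j; exact: frechet_subdiff_convex.
Qed.

Lemma subgradient_limiting h x v : h x \is a fin_num ->
  (forall y (t : R), (h y <= t%:E)%E -> fine (h x) + dotv v (y - x) <= t) ->
  (forall y, h y != -oo%E) -> limiting_subdiff h x v.
Proof.
move=> hx hv hN; split=> //; exists (fun=> x), (fun=> v).
split; try exact: cvg_cst.
move=> _; split=> // e e0; exists 1 => // y _.
have := hN y; case hy: (h y) => [t||] // _; last by rewrite leey.
rewrite -(fineK hx) -EFinD lee_fin.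
have := hv y t; rewrite hy lexx => /(_ isT).
by have := enorm_ge0 (y - x); nra.
Qed.

(* A common description of the epigraph in both forms of the Slater condition:
   a convex set with the Slater point in its relative core, cut out further by
   finitely many affine inequalities. *)
Lemma slater_epigraph h s : epi_convex h -> (forall y, h y != -oo%E) ->
  rel_int (edom h) s \/ (polyhedral_fun h /\ edom h s) ->
  exists (N : nat) (D : set ('cV[R]_k * R^o)) (a : 'I_N -> 'cV[R]_k * R^o -> R) (t : R),
    [/\ convex_subset D, (forall i, affine_fun (a i)),
        (forall x u, (h x <= u%:E)%E <-> D (x, u) /\ forall i, a i (x, u) <= 0),
        rel_core D (s, t) & forall i, a i (s, t) <= 0].
Proof.
move=> cvxh hN [[hs [e e0 eP]]|[[N [a [be [al aP]]]] hs]]; last first.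
  exists N, setT, (fun i w => dotv (a i) w.1 + be i * w.2 - al i), (fine (h s)).
  split=> //.
  - by move=> i t x y /=; rewrite dotvDr !dotvZr /GRing.scale /=; ring.
  - move=> x u; rewrite aP; split=> [H|[_ H]].
      by split=> // i; rewrite subr_le0.
    by move=> i; rewrite -subr_le0; exact: H.
  - by split=> // w _; exists 2 => //; lra.
  - move=> i; rewrite subr_le0; move: i; apply/aP; rewrite fineK //.
    by rewrite fin_numE hN lt_eqF.
have hsfin : h s \is a fin_num by rewrite fin_numE hN lt_eqF.
pose D := [set w : 'cV[R]_k * R^o | (h w.1 <= w.2%:E)%E].
(* The height exceeds [h s] by 1; this slack absorbs the change of height along a prolongation. *)
exists 0%N, D, (fun _ _ => 0), (fine (h s) + 1).
split=> //.
- by move=> t [x u] [y v] t01 /= hx hy; exact: cvxh.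
- by move=> [].
- by move=> x u; split=> [|[]].
split; first by rewrite /D /= EFinD fineK // leeDl.
move=> [w u] /= hw.
(* The point [s'] lies beyond [s] as seen from [w], in the affine hull of the domain and at distance
   [d * M < e] from [s]. *)
pose M := enorm (s - w); have M0 : 0 <= M := enorm_ge0 _.
pose d := e / (M + 1).
have d0 : 0 < d by rewrite divr_gt0 //; lra.
pose s' := s + d *: (s - w).
have : edom h s'.
  apply: eP.
    exists 2, (fun i => if i == ord0 then s else w),
      (fun i => if i == ord0 then 1 + d else - d); split.
    - by move=> i; case: ifP => // _; exact: le_lt_trans (ltry u).
    - by rewrite !big_ord_recl big_ord0 /=; ring.
    - rewrite !big_ord_recl big_ord0 /= addr0 /s' scalerDl scale1r scalerBr.
      by rewrite scaleNr addrA.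
  rewrite /s' addrAC subrr add0r enormZ -/M gtr0_norm // /d mulrAC.
  by rewrite ltr_pdivrMr; nra.
rewrite /edom /= => hs'.
have hs'fin : h s' \is a fin_num by rewrite fin_numE hN lt_eqF.
(* The prolonged point lies over [th *: s' + (1 - th) *: s]. By convexity its height suffices once
   [th * (h s' - h s + d * (u - h s - 1)) <= 1], which holds as [th * K <= 1]. *)
pose K := `|fine (h s') - fine (h s)| + d * `|u - fine (h s) - 1|.
have K0 : 0 <= K by rewrite addr_ge0 // mulr_ge0 // ltW.
pose th := (1 + K)^-1.
have th0 : 0 < th by rewrite invr_gt0; lra.
have thE : th * (1 + K) = 1 by rewrite mulVf // gt_eqF //; lra.
have th1 : 0 <= th <= 1 by nra.
exists (1 + th * d); first by nra.
have := cvxh th s' s (fine (h s')) (fine (h s)) th1.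
rewrite !fineK // !lexx => /(_ isT isT).
have -> : th *: s' + (1 - th) *: s =
    (1 + th * d) *: s + (1 - (1 + th * d)) *: w.
  by apply/colP => i; rewrite !mxE; ring.
move=> H; apply: (le_trans H); rewrite lee_fin.
set p := fine (h s'); set q := fine (h s).
have h1 : p - q <= `|p - q| := ler_norm _.
have h2 : u - q - 1 <= `|u - q - 1| := ler_norm _.
have h3 : d * (u - q - 1) <= d * `|u - q - 1| by apply: ler_wpM2l => //; exact: ltW.
have hK : th * ((p - q) + d * (u - q - 1)) <= th * K.
  by apply: ler_wpM2l; [exact: ltW|rewrite /K -/p -/q; lra].
change (th * p + (1 - th) * q <=
  (1 + th * d) * (q + 1) + (1 - (1 + th * d)) * (u : R)).
clearbody th K d; lra.
Qed.

End Conjugate.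

(** * Stationary points and local minimizers of (D) *)

Section Main.
Variables (R : realType) (n m r : nat).
Variables (f : 'cV[R]_n -> \bar R) (g : 'cV[R]_m -> \bar R).
Variables (A : 'M[R]_(m, n)) (B : 'M[R]_(r, n)) (b mu : 'cV[R]_r).
Hypotheses (pf : proper_fun f) (pg : proper_fun g).
Implicit Types (y : 'cV[R]_m) (z : 'cV[R]_r) (x : 'cV[R]_n).

Local Notation f' := (conj_fun f).
Local Notation g' := (conj_fun g).
Local Notation L y z := (- (A^T *m y) - B^T *m z).

Let f'N p : f' p != -oo%E := conj_fun_neqNy p pf.
Let g'N q : g' q != -oo%E := conj_fun_neqNy q pg.
Let cvxf' : epi_convex f' := conj_fun_epi_convex pf.1.
Let cvxg' : epi_convex g' := conj_fun_epi_convex pg.1.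

Let card_term (z : 'cV[R]_r) i : R := if z i 0 != 0 then mu i 0 else 0.

Lemma dotv_adjoint x y z : dotv x (L y z) = - dotv (A *m x) y - dotv (B *m x) z.
Proof. by rewrite dotvBr dotvNr !dotv_trmx. Qed.

Lemma Gobj_fin y z (t1 t2 : R) : f' (L y z) = t1%:E -> g' y = t2%:E ->
  (forall i, 0 <= z i 0) ->
  Gobj f g A B b mu y z = (t1 + t2 + dotv b z + \sum_i card_term z i)%:E.
Proof.
move=> h1 h2 hz; rewrite /Gobj /Xi h1 h2 /Psi_plus ifT //.
by apply/forallP.
Qed.

Lemma Gobj_ltyP y z : (Gobj f g A B b mu y z < +oo)%E ->
  [/\ f' (L y z) \is a fin_num, g' y \is a fin_num & forall i, 0 <= z i 0].
Proof.
rewrite /Gobj /Xi /Psi_plus; have := f'N (L y z); have := g'N y.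
by case: (f' _) => [t1||] //; case: (g' _) => [t2||] //=; case: ifP => // /forallP.
Qed.

Lemma stationary_local_min ys zs : (forall i, 0 < mu i 0) ->
  stationary_D f g A B b ys zs -> local_min_D f g A B b mu ys zs.
Proof.
move=> mu0 [x [v [u [hx hv [zs0 uT] Ax Bx]]]].
have /fineK f1 : f' (L ys zs) \is a fin_num by case: hx.
have /fineK g1 : g' ys \is a fin_num by case: hv.
(* Within this radius a nonzero coordinate of [zs] stays positive, and at a zero coordinate
   [u i 0 * z i 0] cannot exceed [mu i 0]. *)
pose d i := if zs i 0 != 0 then zs i 0 else mu i 0 / (`|u i 0| + 1).
have [i|e e0 eP] := @finite_pos_lb _ _ d.
  rewrite /d; case: ifPn => zi; first by rewrite lt_def zi zs0.
  by rewrite divr_gt0 // ltr_wpDl.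
exists e => // y z hyz.
have hz i : `|z i 0 - zs i 0| < d i.
  apply: lt_le_trans (eP i); apply: le_lt_trans hyz.
  have -> : z i 0 - zs i 0 = (z - zs) i 0 by rewrite !mxE.
  apply: le_trans (coord_le_enorm _ _) _.
  rewrite -[leLHS]ger0_norm ?enorm_ge0 // -sqrtr_sqr ler_wsqrtr //.
  by rewrite lerDr sqr_ge0.
have [Glt|] := ltP (Gobj f g A B b mu y z) +oo%E; last first.
  by rewrite leye_eq => /eqP ->; exact: leey.
have [/fineK f2 /fineK g2 z0] := Gobj_ltyP Glt.
rewrite (Gobj_fin (esym f1) (esym g1) zs0) (Gobj_fin (esym f2) (esym g2) z0).
rewrite lee_fin.
have := limiting_subdiff_convex cvxf' hx (y := L y z); rewrite -{1}f2 => /(_ _ (lexx _)).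
have := limiting_subdiff_convex cvxg' hv (y := y); rewrite -{1}g2 => /(_ _ (lexx _)).
have : \sum_i card_term zs i + dotv u (z - zs) <= \sum_i card_term z i.
  rewrite -big_split; apply: ler_sum => i _ /=; rewrite /card_term !mxE.
  have := hz i; rewrite /d; case: ifPn => zi.
    have := zs0 i; rewrite le0r (negbTE zi) /= => zi0; rewrite ltr_distl => /andP[lo _].
    rewrite uT // mul0r addr0 ifT // gt_eqF //; lra.
  move: zi; rewrite negbK => /eqP ->; rewrite !subr0 add0r.
  rewrite ltr_pdivlMr ?ltr_wpDl // => hi.
  case: ifPn => [_|]; last by rewrite negbK => /eqP ->; rewrite mulr0.
  have := ler_norm (u i 0 * z i 0); rewrite normrM => H; apply: (le_trans H).
  by have := normr_ge0 (z i 0); nra.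
(* With [A x = v] and [B x = b + u], the two subgradient inequalities add up to a lower bound for
   [Xi] in which only [- dotv u (z - zs)] remains. *)
rewrite (dotvBr x (L y z)) !dotv_adjoint Ax Bx !dotvDl !dotvBr; lra.
Qed.

(** A short enough step [t] towards [(y, z)] preserves the zero pattern and positivity of [zs], even
    when [z] has negative entries. The penalties cancel, and convexity allows division by [t]. *)
Lemma local_min_restricted ys zs : local_min_D f g A B b mu ys zs ->
  (Gobj f g A B b mu ys zs < +oo)%E ->
  forall y z (t1 t2 : R), (f' (L y z) <= t1%:E)%E -> (g' y <= t2%:E)%E ->
    (forall i, zs i 0 = 0 -> z i 0 = 0) ->
    fine (f' (L ys zs)) + fine (g' ys) + dotv b zs <= t1 + t2 + dotv b z.
Proof.
move=> [e e0 eP] /Gobj_ltyP[fs gs zs0] y z t1 t2 h1 h2 zT.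
pose M := Num.sqrt (enorm (y - ys) ^+ 2 + enorm (z - zs) ^+ 2).
have M0 : 0 <= M := sqrtr_ge0 _.
(* Bounds on the step: [None] keeps it below 1 and inside the ball of local minimality, [Some i]
   keeps coordinate [i] positive. *)
pose d (o : option 'I_r) := if o is Some i then
  (if zs i 0 != 0 then zs i 0 / (`|z i 0 - zs i 0| + 1) else 1)
  else Num.min 1 (e / (M + 1)).
have [|t t0 td] := @finite_pos_lb _ _ d.
  move=> [i|] /=.
    by case: ifPn => // zi; rewrite divr_gt0 ?ltr_wpDl // lt_def zi zs0.
  by rewrite lt_min ltr01 divr_gt0 // ltr_wpDl.
have := td None; rewrite /= le_min ler_pdivlMr ?ltr_wpDl // => /andP[t1' tM].
have t01 : 0 <= t <= 1 by rewrite ltW.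
pose yt := t *: y + (1 - t) *: ys; pose zt := t *: z + (1 - t) *: zs.
have yE : yt - ys = t *: (y - ys) by apply/colP => i; rewrite !mxE; ring.
have zE : zt - zs = t *: (z - zs) by apply/colP => i; rewrite !mxE; ring.
have near : Num.sqrt (enorm (yt - ys) ^+ 2 + enorm (zt - zs) ^+ 2) < e.
  rewrite yE zE !enormZ !exprMn -mulrDr sqrtrM ?sqr_ge0 // sqrtr_sqr normr_id.
  by rewrite -/M gtr0_norm //; nra.
have ztE i : (zs i 0 = 0 /\ zt i 0 = 0) \/ (0 < zs i 0 /\ 0 < zt i 0).
  have := td (Some i); rewrite /=; case: ifPn => [zi|].
    rewrite ler_pdivlMr ?ltr_wpDl // => tz; right.
    have zi0 : 0 < zs i 0 by rewrite lt_def zi zs0.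
    split=> //; rewrite !mxE.
    have : - (z i 0 - zs i 0) <= `|z i 0 - zs i 0| by rewrite -normrN ler_norm.
    nra.
  by rewrite negbK => /eqP zi _; left; rewrite !mxE zi zT //; split=> //; ring.
have zt0 i : 0 <= zt i 0 by case: (ztE i) => -[_]; [move=> ->|move/ltW].
have cE : \sum_i card_term zt i = \sum_i card_term zs i.
  apply: eq_bigr => i _; rewrite /card_term.
  by case: (ztE i) => -[]; [move=> -> ->|move=> ? ?; rewrite !gt_eqF].
have LE : L yt zt = t *: L y z + (1 - t) *: L ys zs.
  rewrite /yt /zt !mulmxDr -!scalemxAr.
  by apply/colP => i; rewrite !mxE; ring.
have ft : (f' (L yt zt) <= (t * t1 + (1 - t) * fine (f' (L ys zs)))%:E)%E.
  by rewrite LE; apply: cvxf' => //; rewrite fineK.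
have gt : (g' yt <= (t * t2 + (1 - t) * fine (g' ys))%:E)%E.
  by apply: cvxg' => //; rewrite fineK.
have /fineK ftE : f' (L yt zt) \is a fin_num.
  by rewrite fin_numE f'N lt_eqF // (le_lt_trans ft) // ltry.
have /fineK gtE : g' yt \is a fin_num.
  by rewrite fin_numE g'N lt_eqF // (le_lt_trans gt) // ltry.
have := eP _ _ near.
rewrite (Gobj_fin (esym (fineK fs)) (esym (fineK gs)) zs0).
rewrite (Gobj_fin (esym ftE) (esym gtE) zt0) lee_fin cE.
move: ft gt; rewrite -ftE -gtE !lee_fin /zt dotvDr !dotvZr => ft gt H.
rewrite -(ler_pM2l t0); lra.
Qed.

Lemma local_min_stationary ys zs : local_min_D f g A B b mu ys zs ->
  (Gobj f g A B b mu ys zs < +oo)%E -> slater_D f g A B zs ->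
  stationary_D f g A B b ys zs.
Proof.
move=> lmin Glt [y0 [z0 [sf sg z0T _]]].
have minP := local_min_restricted lmin Glt.
have [fs gs zs0] := Gobj_ltyP Glt.
have [N1 [D1 [a1 [s1 [cvx1 ha1 epi1 core1 sa1]]]]] := slater_epigraph cvxf' f'N sf.
have [N2 [D2 [a2 [s2 [cvx2 ha2 epi2 core2 sa2]]]]] := slater_epigraph cvxg' g'N sg.
pose V : lmodType R := (('cV[R]_n * R^o) * ('cV[R]_m * R^o) * 'cV[R]_r)%type.
pose D12 := [set w : ('cV[R]_n * R^o) * ('cV[R]_m * R^o) | D1 w.1 /\ D2 w.2].
pose D3 := [set z : 'cV[R]_r | forall i, zs i 0 = 0 -> z i 0 = 0].
pose D := [set w : V | D12 w.1 /\ D3 w.2].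
pose val := fine (f' (L ys zs)) + fine (g' ys) + dotv b zs.
pose c (w : V) : R := w.1.1.2 + w.1.2.2 + dotv b w.2 - val.
pose link (w : V) : 'cV[R]_n := w.1.1.1 - L w.1.2.1 w.2.
(* The equation [link w = 0] is encoded as two opposite inequalities per coordinate; the difference
   of their multipliers has free sign and yields [x]. *)
pose a (i : 'I_N1 + 'I_N2 + ('I_n + 'I_n)) (w : V) : R := match i with
  | inl (inl i) => a1 i w.1.1 | inl (inr i) => a2 i w.1.2
  | inr (inl i) => link w i 0 | inr (inr i) => - link w i 0 end.
pose s : V := ((L y0 z0, s1), (y0, s2), z0).
have linkE (t : R) (v w : V) : link (t *: v + (1 - t) *: w) = t *: link v + (1 - t) *: link w.
  rewrite /link /= !mulmxDr -!scalemxAr.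
  by apply/colP => i; rewrite !mxE; ring.
have cvx3 : convex_subset D3.
  by move=> t v w _ v0 w0 i zi; rewrite !mxE v0 // w0 // !mulr0 addr0.
have cvx12 : convex_subset D12.
  by move=> t v w t01 [v1 v2] [w1 w2]; split; [exact: cvx1|exact: cvx2].
have cvxD : convex_subset D.
  by move=> t v w t01 [v12 v3] [w12 w3]; split; [exact: cvx12|exact: cvx3].
have coreD : rel_core D s.
  apply: (rel_core_prod cvx12 cvx3); first exact: (rel_core_prod cvx1 cvx2).
  (* [D3] is a linear subspace, so any prolongation factor works. *)
  split=> // w w3; exists 2; first by lra.
  by move=> i zi; rewrite !mxE z0T // w3 // !mulr0 addr0.
have ha i : affine_fun (a i).
  case: i => [[i|i]|[i|i]] t v w /=; rewrite ?ha1 ?ha2 // linkE !mxE //; ring.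
have hc : affine_fun c.
  by move=> t v w; rewrite /c /= dotvDr !dotvZr /GRing.scale /=; ring.
have sa i : a i s <= 0.
  by case: i => [[i|i]|[i|i]] //=; rewrite /link /= subrr mxE ?oppr0.
have c0 w : D w -> (forall i, a i w <= 0) -> 0 <= c w.
  case: w => [[[p t1] [q t2]] z] [[/= w1 w2] w3] aw.
  have pE : p = L q z.
    apply/eqP; rewrite -subr_eq0; apply/eqP/colP => i; apply/eqP.
    rewrite [X in _ == X]mxE eq_le (aw (inr (inl i))) /= -oppr_le0.
    exact: (aw (inr (inr i))).
  rewrite /c /= subr_ge0; apply: (minP q z t1 t2) => //.
    rewrite -pE; apply/epi1; split=> // i; exact: (aw (inl (inl i))).
  by apply/epi2; split=> // i; exact: (aw (inl (inr i))).
have [lam lam0 lamP] := affine_multipliers_fin cvxD coreD ha hc sa c0.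
pose x : 'cV[R]_n := \col_i (lam (inr (inr i)) - lam (inr (inl i))).
(* On the epigraphs the terms of the [a1] and [a2] inequalities are nonpositive and drop out; only
   the multiplier [x] of the splitting constraint survives. *)
have key p (t1 : R) q (t2 : R) z : (f' p <= t1%:E)%E -> (g' q <= t2%:E)%E ->
    (forall i, zs i 0 = 0 -> z i 0 = 0) ->
    val <= t1 + t2 + dotv b z - dotv x (p - L q z).
  move=> /epi1[D1p a1p] /epi2[D2q a2q] zT.
  have /lamP : D ((p, t1), (q, t2), z) by [].
  rewrite !big_sumType /=.
  have : \sum_i lam (inl (inl i)) * a1 i (p, t1) <= 0.
    by apply: sumr_le0 => i _; apply: mulr_ge0_le0.
  have : \sum_i lam (inl (inr i)) * a2 i (q, t2) <= 0.
    by apply: sumr_le0 => i _; apply: mulr_ge0_le0.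
  have : - dotv x (p - L q z) =
      \sum_i lam (inr (inl i)) * link (p, t1, (q, t2), z) i 0 +
      \sum_i lam (inr (inr i)) * - link (p, t1, (q, t2), z) i 0.
    rewrite -big_split -sumrN; apply: eq_bigr => i _ /=.
    by rewrite [x i 0]mxE /link /=; ring.
  by rewrite /c /=; lra.
have ef : (f' (L ys zs) <= (fine (f' (L ys zs)))%:E)%E by rewrite fineK.
have eg : (g' ys <= (fine (g' ys))%:E)%E by rewrite fineK.
exists x, (A *m x), (B *m x - b); split=> //.
(* Varying [p], [q] or [z] alone in [key] gives in turn the subgradient of [f'], that of [g'], and
   the condition on [u]. *)
- apply: subgradient_limiting => // p t hp.
  have := key p t ys _ zs hp eg (fun _ => id); rewrite /val dotvBr dotvBr; lra.
- apply: subgradient_limiting => // q t hq.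
  have := key (L ys zs) _ q t zs ef hq (fun _ => id).
  rewrite /val !dotvBr !dotvNr !dotv_trmx; lra.
- split=> // i zi; apply/eqP; rewrite eq_le.
  (* Coordinate [i] is free in [D3], so [k] may take either sign, which forces equality. *)
  have H (k : R) : 0 <= k * (b - B *m x) i 0.
    have := key (L ys zs) _ ys _ (zs + k *: delta_mx i 0) ef eg.
    have zkT : D3 (zs + k *: delta_mx i 0).
      move=> j zj; rewrite !mxE zj add0r; case: eqP => [ji|_]; last by rewrite mulr0.
      by rewrite -ji zj eqxx in zi.
    move=> /(_ zkT); rewrite -dotv_delta dotvBl /val.
    by rewrite !dotvBr !dotvNr !dotv_trmx !dotvDr !dotvZr; lra.
  by have := H 1; have := H (-1); rewrite !mxE => ? ?; lra.
- by rewrite addrC subrK.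
Qed.

End Main.

Theorem mainTheorem14 (R : realType) (n m r : nat)
  (f : 'cV[R]_n -> \bar R) (g : 'cV[R]_m -> \bar R)
  (A : 'M[R]_(m, n)) (B : 'M[R]_(r, n)) (b mu : 'cV[R]_r)
  (hf : [/\ proper_fun f, lsc_fun f & convex_fun f])
  (hg : [/\ proper_fun g, lsc_fun g & convex_fun g])
  (hmu : forall i, 0 < mu i 0) :
  (forall (ys : 'cV[R]_m) (zs : 'cV[R]_r),
      stationary_D f g A B b ys zs -> local_min_D f g A B b mu ys zs) /\
  (forall (ys : 'cV[R]_m) (zs : 'cV[R]_r),
      local_min_D f g A B b mu ys zs ->
      (Gobj f g A B b mu ys zs < +oo)%E ->
      slater_D f g A B zs ->
      stationary_D f g A B b ys zs).
Proof.
case: hf hg => pf _ _ [pg _ _]; split=> ys zs.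
  exact: stationary_local_min.
exact: local_min_stationary.
Qed.
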